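(* For all positive integers $m,n$, $$\sum_{k=1}^n \left[\begin{matrix}2n\\ n-k\end{matrix}\right]k^{1+2m} = \sum_{\ell=0}^m \left\langle 2n-\tfrac12\right\rangle_{2\ell}\left\{\frac{2n-2\ell-1}{4(-1)^\ell}\left[\begin{matrix}2n-2\ell\\ n-\ell\end{matrix}\right] + \frac{1+2\ell}{4}\left[\begin{matrix}2n-\ell\\ \ell\end{matrix}\right]^{-1}\right\}\sigma_{m,\ell}\left(n-\tfrac12\right).$$
   Context: Rising factorial: $(x)_0=1$, $(x)_j=x(x+1)\cdots(x+j-1)$ for positive integers $j$, and for negative integers $j$, $(\tfrac12)_j = 1/(\tfrac12+j)_{-j}$. Falling factorial: $\langle x\rangle_0=1$, $\langle x\rangle_j=x(x-1)\cdots(x-j+1)$ for positive integers $j$. For integers $N,j$, $\left[\begin{matrix}N\\ j\end{matrix}\right]=\frac{(\frac12)_N}{(\frac12)_j(\frac12)_{N-j}}$ (this reduces to the usual definition for $0\le j\le N$ and is used with the stated convention when indices are negative). For nonnegative integers $\ell\le m$ and an indeterminate $y$, $\sigma_{m,\ell}(y)$ denotes the coefficient of $T^{m-\ell}$ in the formal power series $\prod_{j=0}^{\ell} \frac{1}{1-T(y-j)^2}$; equivalently $\sigma_{m,\ell}(y)=\sum_{0\le k_1\le\cdots\le k_{m-\ell}\le \ell}\prod_{i=1}^{m-\ell}(y-k_i)^2$. *)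

(* Defs.v *)
From HB Require Import structures.
From mathcomp Require Import all_boot all_order all_algebra.

Set Implicit Arguments.
Unset Strict Implicit.
Unset Printing Implicit Defensive.

Import Order.TTheory GRing.Theory Num.Theory.
Local Open Scope ring_scope.

Definition rising (x : rat) (j : nat) : rat := \prod_(i < j) (x + i%:R).

Definition falling (x : rat) (j : nat) : rat := \prod_(i < j) (x - i%:R).

(* (1/2)_j for every integer j; since Negz k stands for - k.+1, the second
   branch is 1 / (1/2 + j)_(-j). *)
Definition half_rising (j : int) : rat :=
  match j with
  | Posz k => rising (1 / 2) k
  | Negz k => (rising (1 / 2 - k.+1%:R) k.+1)^-1
  end.

Definition half_binom (N j : int) : rat :=
  half_rising N / (half_rising j * half_rising (N - j)).

(* A formal power series in T is the sequence of its coefficients. *)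
Section PowerSeries.
Variable R : comUnitRingType.
Implicit Types f g : nat -> R.

Definition fps_one : nat -> R := fun d => (d == 0)%:R.

Definition fps_mul f g : nat -> R := fun d => \sum_(i < d.+1) f i * g (d - i)%N.

(* The first d coefficients of 1 / f, by the recursion
   b_d = - f_0^-1 * \sum_(i < d) f_(d - i) b_i obtained from f * (1 / f) = 1. *)
Fixpoint fps_inv_seq f (d : nat) : seq R :=
  if d is d'.+1 then
    let b := fps_inv_seq f d' in
    rcons b ((f 0)^-1 * (fps_one d' - \sum_(i < d') f (d' - i)%N * b`_i))
  else [::].

Definition fps_inv f : nat -> R := fun d => (fps_inv_seq f d.+1)`_d.

(* 1 - a T *)
Definition fps_1subX (a : R) : nat -> R :=
  fun d => (d == 0)%:R - a *+ (d == 1)%N.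

(* The coefficient of T^(m - l) in \prod_(0 <= j <= l) 1 / (1 - T (y - j)^2);
   only meaningful for l <= m, as m - l is truncated. *)
Definition sigma (m l : nat) (y : R) : R :=
  (\big[fps_mul/fps_one]_(j < l.+1) fps_inv (fps_1subX ((y - j%:R) ^+ 2)))
    (m - l)%N.

Lemma size_fps_inv_seq f d : size (fps_inv_seq f d) = d.
Proof. by elim: d => //= d IHd; rewrite size_rcons IHd. Qed.

Lemma nth_fps_inv_seq f d i : (i < d)%N -> (fps_inv_seq f d)`_i = fps_inv f i.
Proof.
elim: d => // d IHd; rewrite ltnS leq_eqVlt => /orP[/eqP-> //|lt_id].
by rewrite /= nth_rcons size_fps_inv_seq lt_id IHd.
Qed.

Lemma fps_mulV f : f 0 \is a GRing.unit -> fps_mul f (fps_inv f) =1 fps_one.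
Proof.
move=> Uf d; rewrite /fps_mul big_ord_recl subn0.
rewrite {1}/fps_inv /= nth_rcons size_fps_inv_seq ltnn eqxx mulVKr //.
rewrite (reindex_inj rev_ord_inj) /=.
rewrite -addrA -[RHS]addr0; congr (_ + _); apply/eqP; rewrite addrC subr_eq0.
apply/eqP/eq_bigr => i _; rewrite nth_fps_inv_seq /=.
  by rewrite /bump leq0n add1n subKn.
by rewrite subnSK // leq_subr.
Qed.

End PowerSeries.

(* Main.v *)
(* With a_j = (y - j)^2, the complete homogeneous sums sigma_{m,l} are the
   coefficients of the Newton interpolation of x^m at a_0, a_1, ...:
     x^m = \sum_l sigma_{m,l}(y) \prod_{j<l} (x - a_j).
   Take x = k^2 and y = n - 1/2. The factors of
   k^2 - (n-1/2-j)^2 = - (n-k-1/2-j) (n+k-1/2-j) are exactly the top factors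
   of (1/2)_{n-k} and (1/2)_{n+k}, so the l-th product turns [2n; n-k] into
   (-1)^l <2n-1/2>_{2l} [2N; N-k] with N = n - l, possibly negative. The sum
   \sum_k k [2N; N-k] then telescopes, since
     2k / ((1/2)_{N-k} (1/2)_{N+k}) = G k - G (k+1)
   where G k = 1 / ((1/2)_{N-k} (1/2)_{N+k-1}). *)
Require Import Defs.
From mathcomp Require Import all_boot all_order all_algebra.
From mathcomp Require Import ring lra zify.
Import Order.TTheory GRing.Theory Num.Theory.
Local Open Scope ring_scope.

(** * Newton interpolation of powers at arbitrary nodes *)

Section NewtonExpansion.
Variable R : comUnitRingType.
Implicit Types (a : nat -> R) (c x : R) (g : nat -> R).

Lemma fps_inv_1subX c d : fps_inv (fps_1subX c) d = c ^+ d.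
Proof.
have U : fps_1subX c 0 \is a GRing.unit.
  by rewrite /fps_1subX eqxx mulr0n subr0 unitr1.
elim: d => [|d IHd]; have := fps_mulV U.
  move=> /(_ 0%N); rewrite /fps_mul big_ord1 /fps_1subX /fps_one /=.
  by rewrite mulr0n subr0 mul1r.
move=> /(_ d.+1); rewrite /fps_mul !big_ord_recl big1 => [|i _].
  rewrite /fps_1subX /fps_one /bump /= !mulr0n subr0 mul1r mulr1n subn0.
  rewrite sub0r addr0 subn1 /= IHd mulNr => /eqP.
  by rewrite subr_eq0 exprS => /eqP.
by rewrite /fps_1subX /bump /= !mulr0n subr0 mul0r.
Qed.

(** The series [h = g / (1 - c T)] satisfies [h = g + c T h]. *)
Lemma fps_mul_geometricS c g d :
  fps_mul (fps_inv (fps_1subX c)) g d.+1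
  = g d.+1 + c * fps_mul (fps_inv (fps_1subX c)) g d.
Proof.
rewrite /fps_mul big_ord_recl fps_inv_1subX expr0 mul1r subn0; congr (_ + _).
rewrite mulr_sumr; apply: eq_bigr => i _.
by rewrite !fps_inv_1subX lift0 subSS exprS mulrA.
Qed.

Lemma fps_mul_geometric0 c g :
  fps_mul (fps_inv (fps_1subX c)) g 0 = g 0%N.
Proof. by rewrite /fps_mul big_ord1 fps_inv_1subX expr0 mul1r. Qed.

(** Complete homogeneous polynomials in [a_0, ..., a_l], indexed by degree. Arbitrary nodes replace
    the squares in [sigma] so that an induction can shift them. *)
Definition complete_homogeneous a (l : nat) : nat -> R :=
  \big[@fps_mul R/@fps_one R]_(j < l.+1) fps_inv (fps_1subX (a j)).

Lemma complete_homogeneous_recl a l :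
  complete_homogeneous a l.+1
  = fps_mul (fps_inv (fps_1subX (a 0%N)))
            (complete_homogeneous (fun j => a j.+1) l).
Proof. by rewrite /complete_homogeneous big_ord_recl. Qed.

Lemma complete_homogeneous1 a d : complete_homogeneous a 0 d = a 0%N ^+ d.
Proof.
rewrite /complete_homogeneous big_ord_recl big_ord0.
elim: d => [|d IHd]; first by rewrite fps_mul_geometric0 expr0.
by rewrite fps_mul_geometricS IHd /fps_one add0r exprS.
Qed.

Lemma newton_expansion m a x :
  x ^+ m = \sum_(l < m.+1)
             complete_homogeneous a l (m - l)%N * \prod_(j < l) (x - a j).
Proof.
elim: m a => [|m IHm] a.
  by rewrite big_ord1 big_ord0 complete_homogeneous1 !expr0 mulr1.
pose a' j := a j.+1.
have splitP l : \prod_(j < l.+1) (x - a j)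
                = (x - a 0%N) * \prod_(j < l) (x - a' j).
  by rewrite big_ord_recl.
(* The terms [l >= 1] of the expansion of [x^(m+1)]: splitting off the node [a_0] leaves [x - a_0]
   times [x^m] expanded at the shifted nodes, plus [a_0] times the expansion of [x^m] at [a] without
   its constant term. *)
have E : \sum_(l < m.+1)
            complete_homogeneous a l.+1 (m - l)%N * \prod_(j < l.+1) (x - a j)
  = (x - a 0%N) * x ^+ m
    + a 0%N * \sum_(l < m) complete_homogeneous a l.+1 (m - l.+1)%N
                            * \prod_(j < l.+1) (x - a j).
  rewrite {1}(IHm a') mulr_sumr !big_ord_recr /= mulr_sumr.
  rewrite [RHS]addrAC -big_split /=; congr (_ + _).
    apply: eq_bigr => l _; rewrite splitP complete_homogeneous_recl.
    rewrite -(subnSK (ltn_ord l)) fps_mul_geometricS -/a'.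
    by ring.
  (* In the top term the coefficient has degree 0, so the split gives no [a_0] part. *)
  have := splitP m; rewrite big_ord_recr /= => ->.
  by rewrite complete_homogeneous_recl subnn fps_mul_geometric0 mulrCA.
rewrite big_ord_recl big_ord0 mulr1 subn0 complete_homogeneous1.
under eq_bigr => l _ do rewrite lift0 subSS.
rewrite E.
have := IHm a; rewrite big_ord_recl big_ord0 mulr1 subn0 complete_homogeneous1.
under eq_bigr => l _ do rewrite lift0.
move=> /eqP; rewrite addrC -subr_eq => /eqP <-.
by rewrite !exprS; ring.
Qed.

End NewtonExpansion.

(** * The rising factorial of 1/2 at integer indices *)

Lemma half_int_neq0 (j : int) : (1 / 2 + j%:~R : rat) != 0.
Proof.
apply/eqP => H; have : ((1 + 2 * j)%:~R : rat) = 0.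
  by rewrite intrD intrM; lra.
by move/eqP; rewrite intr_eq0 => /eqP; lia.
Qed.

(** One recurrence across both branches of the definition; below 0, the new factor cancels the first
    factor of the inverted product. *)
Lemma half_risingS (j : int) :
  half_rising (j + 1) = half_rising j * (1 / 2 + j%:~R).
Proof.
case: j => [k|k].
  have -> : (Posz k + 1 = Posz k.+1)%R by lia.
  by rewrite /= /rising big_ord_recr.
have E : rising (1 / 2 - k.+1%:R) k.+1
       = (1 / 2 + (Negz k)%:~R) * rising (1 / 2 - k%:R) k.
  rewrite /rising big_ord_recl NegzE intrN addr0; congr (_ * _).
  by apply: eq_bigr => i _; rewrite lift0 -!natr1; ring.
have -> : half_rising (Negz k + 1) = (rising (1 / 2 - k%:R) k)^-1.
  case: k {E} => [|k]; first by rewrite /= /rising !big_ord0 invr1.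
  by have -> : Negz k.+1 + 1 = Negz k by lia.
by rewrite [half_rising (Negz k)]/= E invfM mulrAC mulVf ?mul1r ?half_int_neq0.
Qed.

Lemma half_rising0 : half_rising 0 = 1.
Proof. by rewrite /= /rising big_ord0. Qed.

(** Induction both ways from 0; downwards, a nonzero product has nonzero factors. *)
Lemma half_rising_neq0 (j : int) : half_rising j != 0.
Proof.
elim/int_rect: j => [|k IH|k IH].
- by rewrite half_rising0 oner_neq0.
- have -> : Posz k.+1 = Posz k + 1 by lia.
  by rewrite half_risingS mulf_neq0 ?half_int_neq0.
- move: IH; have -> : - Posz k = - Posz k.+1 + 1 by lia.
  by rewrite half_risingS mulf_eq0 negb_or => /andP[].
Qed.

Lemma half_rising_sub (j : int) (l : nat) :
  half_rising j = half_rising (j - l%:Z) * falling (j%:~R - 1 / 2) l.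
Proof.
rewrite /falling; elim: l => [|l IHl]; first by rewrite big_ord0 subr0 mulr1.
rewrite big_ord_recr /= IHl.
have -> : j - l%:Z = j - l.+1%:Z + 1 by lia.
by rewrite half_risingS intrB -pmulrn -[l.+1%:R]natr1; field.
Qed.

(** The inverted factors [1/2 - l, ..., -1/2] are the negatives of those of [(1/2)_l]. *)
Lemma half_rising_opp (l : nat) :
  half_rising (- l%:Z) = (-1) ^+ l / half_rising l%:Z.
Proof.
elim: l => [|l IHl]; first by rewrite oppr0 half_rising0 expr0 divr1.
have := half_risingS (- l.+1%:Z).
have -> : - l.+1%:Z + 1 = - l%:Z by lia.
have -> : l.+1%:Z = l%:Z + 1 by lia.
rewrite IHl half_risingS exprS.
have := half_int_neq0 l; have := half_rising_neq0 l.
have := half_int_neq0 (- (l%:Z + 1)).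
rewrite !intrN !intrD -pmulrn.
move: (half_rising (- _)) (half_rising _) => v u n1 n2 n3 H.
have -> : v = (-1) ^+ l / u / (1 / 2 - (l%:R + 1)) by rewrite H mulfK.
by field; rewrite n2 /=; apply/andP; split; [move: n3|move: n1];
  apply: contra => /eqP E; apply/eqP; lra.
Qed.

(** * Closed form of each Newton term *)

Lemma telescoping_sum (N : int) (n : nat) :
  \sum_(1 <= k < n.+1)
     k%:R / (half_rising (N - k%:Z) * half_rising (N + k%:Z))
  = (half_rising (N - 1) * half_rising N)^-1 / 2
    - (half_rising (N - n.+1%:Z) * half_rising (N + n%:Z))^-1 / 2.
Proof.
(* The sign makes the summand [G (k+1) - G k]; the half absorbs the 2 in
   [2k = (N+k-1/2) - (N-k-1/2)]. *)
pose G k := - ((half_rising (N - k%:Z) * half_rising (N + k%:Z - 1))^-1 / 2).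
rewrite (telescope_sumr_eq G) // => [|k _].
  rewrite /G opprK addrC addrK.
  by have -> : N + n.+1%:Z - 1 = N + n%:Z by lia.
rewrite /G.
have -> : N + k.+1%:Z - 1 = N + k%:Z by lia.
have := half_risingS (N - k.+1%:Z); have := half_risingS (N + k%:Z - 1).
have -> : N - k.+1%:Z + 1 = N - k%:Z by lia.
have -> : N + k%:Z - 1 + 1 = N + k%:Z by lia.
have := half_rising_neq0 (N - k.+1%:Z).
have := half_rising_neq0 (N + k%:Z - 1).
have := half_int_neq0 (N - k.+1%:Z); have := half_int_neq0 (N + k%:Z - 1).
move=> n1 n2 n3 n4 -> ->; move: n1 n2.
rewrite !intrD !intrN -!pmulrn -[k.+1%:R]natr1 => n1 n2.
move: (half_rising _) (half_rising _) n3 n4 => u v n3 n4.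
field; rewrite n3 n4 /=.
by apply/andP; split; [move: n2|move: n1]; apply: contra => /eqP E; apply/eqP; lra.
Qed.

Lemma falling_neq0 (j : int) (l : nat) : falling (j%:~R - 1 / 2) l != 0.
Proof.
have := half_rising_neq0 j.
by rewrite (half_rising_sub j l) mulf_eq0 negb_or => /andP[].
Qed.

(** [(1/2)_{2n}] stays whole: only the denominators depend on [k]. *)
Lemma half_binom_mul_prod (n k l : nat) :
  half_binom (2 * n%:Z) (n%:Z - k%:Z)
    * \prod_(j < l) (k%:R ^+ 2 - (n%:R - 1 / 2 - j%:R) ^+ 2)
  = (-1) ^+ l * half_rising (2 * n%:Z)
    / (half_rising (n%:Z - l%:Z - k%:Z) * half_rising (n%:Z - l%:Z + k%:Z)).
Proof.
have -> : \prod_(j < l) (k%:R ^+ 2 - (n%:R - 1 / 2 - j%:R) ^+ 2) = (-1) ^+ l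
   * (falling ((n%:Z - k%:Z)%:~R - 1 / 2) l
      * falling ((n%:Z + k%:Z)%:~R - 1 / 2) l) :> rat.
  rewrite /falling -big_split /= -[l in (-1) ^+ l]card_ord -prodr_const.
  rewrite -big_split /=; apply: eq_bigr => j _.
  by rewrite intrB intrD -!pmulrn; field.
rewrite /half_binom.
have -> : 2 * n%:Z - (n%:Z - k%:Z) = n%:Z + k%:Z by lia.
rewrite (half_rising_sub (n%:Z - k%:Z) l) (half_rising_sub (n%:Z + k%:Z) l).
have -> : n%:Z - k%:Z - l%:Z = n%:Z - l%:Z - k%:Z by lia.
have -> : n%:Z + k%:Z - l%:Z = n%:Z - l%:Z + k%:Z by lia.
have := falling_neq0 (n%:Z - k%:Z) l; have := falling_neq0 (n%:Z + k%:Z) l.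
have := half_rising_neq0 (n%:Z - l%:Z - k%:Z).
have := half_rising_neq0 (n%:Z - l%:Z + k%:Z).
move: (falling _ _) (falling _ _) (half_rising _) (half_rising _).
by move=> a b c d n1 n2 n3 n4; field; rewrite n1 n2 n3 n4.
Qed.

(** The boundary value at [k = 1] gives the first term in braces; the one at [k = n+1] has index
    [-(l+1)] and, by reflection, gives the second. *)
Lemma newton_term_sum (n l : nat) :
  \sum_(1 <= k < n.+1)
     half_binom (2 * n%:Z) (n%:Z - k%:Z)
     * \prod_(j < l) (k%:R ^+ 2 - (n%:R - 1 / 2 - j%:R) ^+ 2) * k%:R
  = falling (2 * n%:R - 1 / 2) (2 * l)
    * ((2 * n%:R - 2 * l%:R - 1) / (4 * (-1) ^+ l)
         * half_binom (2 * n%:Z - 2 * l%:Z) (n%:Z - l%:Z)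
       + (1 + 2 * l%:R) / 4 * (half_binom (2 * n%:Z - l%:Z) l%:Z)^-1).
Proof.
under eq_bigr => k _ do rewrite half_binom_mul_prod mulrAC -mulrA.
rewrite -mulr_sumr telescoping_sum /half_binom.
have -> : n%:Z - l%:Z - n.+1%:Z = - l.+1%:Z by lia.
have -> : n%:Z - l%:Z + n%:Z = 2 * n%:Z - l%:Z by lia.
have -> : 2 * n%:Z - 2 * l%:Z - (n%:Z - l%:Z) = n%:Z - l%:Z by lia.
have -> : 2 * n%:Z - l%:Z - l%:Z = 2 * n%:Z - 2 * l%:Z by lia.
rewrite half_rising_opp.
have -> : l.+1%:Z = l%:Z + 1 by lia.
rewrite half_risingS exprS.
have := half_risingS (n%:Z - l%:Z - 1); rewrite subrK => EN.
have := half_rising_sub (2 * n%:Z) (2 * l).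
have -> : (2 * l)%:Z = 2 * l%:Z by lia.
rewrite intrM -!pmulrn => E2; rewrite E2 EN.
have nN := half_int_neq0 (n%:Z - l%:Z - 1).
have nl := half_int_neq0 l%:Z.
have n1 := half_rising_neq0 (n%:Z - l%:Z - 1).
have n2 := half_rising_neq0 (2 * n%:Z - 2 * l%:Z).
have n3 := half_rising_neq0 (2 * n%:Z - l%:Z).
have n4 := half_rising_neq0 l%:Z.
move: (falling _ _) (half_rising _) (half_rising _) (half_rising _)
  (half_rising _) n1 n2 n3 n4 nN nl.
move=> f a b c d nd nc nb na; rewrite !intrB -!pmulrn => nN nl.
have tN : 1 + (n%:R - l%:R - 1) * 2 != 0 :> rat.
  by apply: contra nN => /eqP E; apply/eqP; lra.
have tl : 1 + l%:R * 2 != 0 :> rat.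
  by apply: contra nl => /eqP E; apply/eqP; lra.
(* The sign occurs both as a factor and inverted, so its two values are treated separately. *)
have [->|->] : (-1) ^+ l = 1 :> rat \/ (-1) ^+ l = -1 :> rat.
- by rewrite -signr_odd; case: odd; [right|left].
- by field; rewrite na nb nc nd tN tl.
- by field; rewrite na nb nc nd tN tl.
Qed.

Theorem theorem14 (m n : nat) (hm : (0 < m)%N) (hn : (0 < n)%N) :
  \sum_(1 <= k < n.+1)
     half_binom (2 * n%:Z) (n%:Z - k%:Z) * (k%:R : rat) ^+ (1 + 2 * m)
  = \sum_(0 <= l < m.+1)
      falling (2 * n%:R - 1 / 2) (2 * l)
      * ((2 * n%:R - 2 * l%:R - 1) / (4 * (-1) ^+ l)
           * half_binom (2 * n%:Z - 2 * l%:Z) (n%:Z - l%:Z)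
         + (1 + 2 * l%:R) / 4 * (half_binom (2 * n%:Z - l%:Z) l%:Z)^-1)
      * sigma m l (n%:R - 1 / 2 : rat).
Proof.
pose a j : rat := (n%:R - 1 / 2 - j%:R) ^+ 2.
(* After exchanging the sums, each [k] needs only [k (k^2)^m] with the power expanded at the nodes
   [a]. *)
under [RHS]eq_bigr => l _ do rewrite -newton_term_sum mulr_suml.
rewrite exchange_big /=; apply: eq_bigr => k _.
rewrite exprD exprM expr1 (newton_expansion _ m a) !mulr_sumr big_mkord.
by apply: eq_bigr => l _; rewrite /sigma /complete_homogeneous; ring.
Qed.
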